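(* Let $r\ge 2$ be an integer and let $\varepsilon>0$. Then there exist $C=C(r,\varepsilon)$ and $K=K(r,\varepsilon)$ such that if $p\ge C/n$, the random graph $G\sim G(n,p)$ is with high probability such that in any $r$-colouring of its edges there exists a path of length at least $(2/(r+1)-\varepsilon)n$ in which all but at most $K$ of the edges have the same colour.
   Context: $G(n,p)$ is the binomial random graph on $n$ labelled vertices in which each pair is an edge independently with probability $p$. With high probability means with probability tending to $1$ as $n\to\infty$. The length of a path is its number of edges. *)

(* Defs.v *)
From HB Require Import structures.
From mathcomp Require Import all_boot all_order all_algebra.
From mathcomp Require Import all_classical all_reals all_analysis.
Set Implicit Arguments.
Unset Strict Implicit.
Unset Printing Implicit Defensive.
Import Order.TTheory GRing.Theory Num.Theory.
Import numFieldNormedType.Exports.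
Local Open Scope classical_set_scope.
Local Open Scope ring_scope.

Definition pairs (V : finType) : {set {set V}} := [set e : {set V} | #|e| == 2%N]%SET.

(* A simple graph on [V] is given by its edge set, a subset of [pairs V]. *)
Definition adj (V : finType) (E : {set {set V}}) : rel V :=
  fun u v => [set u; v]%SET \in E.

(* [x :: s] lists the vertices of a path, which are pairwise distinct; the
   length (number of edges) of the path is [size s]. *)
Definition is_path (V : finType) (E : {set {set V}}) (x : V) (s : seq V) : bool :=
  path (adj E) x s && uniq (x :: s).

Definition path_edges (V : finType) (x : V) (s : seq V) : seq {set V} :=
  pairmap (fun u v => [set u; v]%SET) x s.

(* For [E] a subset of [pairs 'I_n], the probability that G(n,p) has edge set
   exactly [E]: one independent factor for each pair of vertices. *)
Definition gnp_weight (R : realType) (n : nat) (p : R)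
    (E : {set {set 'I_n}}) : R :=
  \prod_(e in pairs 'I_n) (if e \in E then p else 1 - p).

Definition gnp_prob (R : realType) (n : nat) (p : R)
    (A : set {set {set 'I_n}}) : R :=
  \sum_(E in powerset (pairs 'I_n) | `[< A E >]) gnp_weight p E.

(* A colouring is given on all sets of vertices, but only its values on the
   edges in [E] matter; when [0 < r], every colouring of [E] arises this way. *)
Definition almost_mono_path (R : realType) (n r K : nat) (l : R)
    (E : {set {set 'I_n}}) : Prop :=
  forall c : {set 'I_n} -> 'I_r,
    exists (x : 'I_n) (s : seq 'I_n),
      [/\ is_path E x s,
          l <= (size s)%:R
        & exists i : 'I_r,
            (count (fun e => c e != i) (path_edges x s) <= K)%N].

Lemma gnp_prob_setT (R : realType) (n : nat) (p : R) :
  gnp_prob p [set: {set {set 'I_n}}] = 1.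
Proof.
rewrite /gnp_prob.
under eq_bigl do rewrite asboolT // andbT powersetE.
pose P := pairs 'I_n.
pose F (e : {set 'I_n}) : R := if e \in P then p else 0.
pose G (e : {set 'I_n}) : R := if e \in P then 1 - p else 1.
have <- : \prod_e (F e + G e) = 1.
  by apply: big1 => e _; rewrite /F /G; case: ifP => _; rewrite ?add0r // addrC subrK.
rewrite bigA_distr [RHS](bigID (fun E : {set {set 'I_n}} => E \subset P)) /=.
rewrite [X in _ = _ + X]big1 ?addr0; last first.
  move=> E /subsetPn[e eE eP]; apply/eqP/prodf_eq0; exists e => //.
  by rewrite eE /F (negbTE eP).
apply: eq_bigr => E EP; rewrite /gnp_weight big_mkcond /=.
apply: eq_bigr => e _; rewrite /F /G -/P.
case: (boolP (e \in P)) => // eP.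
by case: (boolP (e \in E)) => // /(fintype.subsetP EP); rewrite (negbTE eP).
Qed.

(* Main.v *)
Require Import Defs.
From HB Require Import structures.
From mathcomp Require Import all_boot all_order all_algebra.
From mathcomp Require Import zify ring lra.
Set Implicit Arguments.
Unset Strict Implicit.
Unset Printing Implicit Defensive.

(* Only one property of the random graph is used: any two disjoint linear-sized
   sets of vertices span an edge. Given a colouring, any two disjoint sets of
   moderately small linear size then contain a "good pair" for some colour [i]:
   sets [A], [B] of equal size such that colour [i] has an edge between any two
   not too small subsets of [A] and [B]. Depth-first search finds a
   monochromatic path covering almost all of such a pair, even after [A] and [B]
   are shrunk to a fixed fraction, and boundedly many disjoint paths are joined
   into one by edges of arbitrary colour, which are the [K] exceptions.

   It remains to cover a [2/(r+1)] fraction of the vertices by disjoint good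
   pairs of one colour. For each colour, a locally optimal fractional packing of
   good pairs comes with prices on the vertices which form a fractional vertex
   cover of hardly larger total weight. These covers are rounded to values in
   [{0, 1/2, 1}]; any two frequent vectors of values [f], [g] satisfy
   [f i + g i >= 1] for some [i], which forces one of the covers to have weight
   about [n/(r+1)], a fractional analogue of the Cockayne-Lorimer theorem. *)

(** * Linked pairs of sets in an edge-coloured graph *)

Lemma exists_subset (V : finType) (A : {set V}) m :
  m <= #|A| -> exists2 B : {set V}, B \subset A & #|B| = m.
Proof.
move=> mA; exists [set x in take m (enum A)].
  by apply/subsetP => x; rewrite inE => /mem_take; rewrite mem_enum.
rewrite cardsE (card_uniqP _) ?take_uniq ?enum_uniq //.
by rewrite size_takel // -cardE.
Qed.

(** Absence of a bipartite hole of size [k] between [A] and [B]. *)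
Definition linked (V : finType) (e : rel V) (k : nat) (A B : {set V}) : bool :=
  [forall A' : {set V}, forall B' : {set V},
    [&& A' \subset A, B' \subset B, k <= #|A'| & k <= #|B'|] ==>
    [exists a in A', exists b in B', e a b]].

Lemma linkedP (V : finType) (e : rel V) k (A B : {set V}) :
  reflect (forall A' B' : {set V}, A' \subset A -> B' \subset B ->
             k <= #|A'| -> k <= #|B'| ->
             exists a b, [/\ a \in A', b \in B' & e a b])
          (linked e k A B).
Proof.
apply: (iffP forallP) => [H A' B' sA sB kA kB | H A'].
  have /forallP/(_ B') := H A'; rewrite sA sB kA kB /=.
  by case/exists_inP => a aA /exists_inP[b bB eab]; exists a, b.
apply/forallP => B'; apply/implyP => /and4P[sA sB kA kB].
have [a [b [aA bB eab]]] := H _ _ sA sB kA kB.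
by apply/exists_inP; exists a => //; apply/exists_inP; exists b.
Qed.

Lemma linkedS (V : finType) (e : rel V) k (A B A1 B1 : {set V}) :
  A1 \subset A -> B1 \subset B -> linked e k A B -> linked e k A1 B1.
Proof.
move=> sA sB /linkedP H; apply/linkedP => A' B' sA' sB'.
by apply: H; [apply: subset_trans sA | apply: subset_trans sB].
Qed.

(** Treat the colours one after another. If colour [j] is not linked, the failure provides subsets
    of size at least [m j.+1] with no edge of colour [j], and the search continues inside them;
    after all [r] colours no edge would be left. *)
Lemma linked_pair_exists (V : finType) r (e : 'I_r -> rel V) (m : nat -> nat)
    (X Y : {set V}) :
  (forall X' Y' : {set V}, [disjoint X' & Y'] -> m r <= #|X'| -> m r <= #|Y'| ->
     exists i a b, [/\ a \in X', b \in Y' & e i a b]) ->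
  [disjoint X & Y] -> m 0 <= #|X| -> m 0 <= #|Y| ->
  exists (i : 'I_r) (A B : {set V}),
    [/\ A \subset X, B \subset Y, #|A| = m i, #|B| = m i
      & linked (e i) (m i.+1) A B].
Proof.
move=> He dXY mX mY.
suff H j : j <= r ->
    (exists (i : 'I_r) (A B : {set V}),
      [/\ A \subset X, B \subset Y, #|A| = m i, #|B| = m i
        & linked (e i) (m i.+1) A B]) \/
    (exists A B : {set V}, [/\ A \subset X, B \subset Y, m j <= #|A|, m j <= #|B|
       & forall (i : 'I_r) a b, i < j -> a \in A -> b \in B -> ~~ e i a b]).
  have [//|[A [B [sA sB mA mB Hn]]]] := H r (leqnn r).
  have dAB : [disjoint A & B] := disjointW sA sB dXY.
  have [i [a [b [aA bB eab]]]] := He _ _ dAB mA mB.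
  by have := Hn i a b (ltn_ord i) aA bB; rewrite eab.
elim: j => [_|j IHj jr]; first by right; exists X, Y; split.
have [|[A [B [sA sB mA mB Hn]]]] := IHj (ltnW jr); first by left.
have [A1 sA1 cA1] := exists_subset mA; have [B1 sB1 cB1] := exists_subset mB.
have [L|] := boolP (linked (e (Ordinal jr)) (m j.+1) A1 B1).
  left; exists (Ordinal jr), A1, B1; split => //.
    exact: subset_trans sA.
  exact: subset_trans sB.
move=> /forallPn[A2 /forallPn[B2]]; rewrite negb_imply.
case/andP => /and4P[sA2 sB2 kA kB] /exists_inPn Hno.
right; exists A2, B2; split => //.
- by apply: subset_trans sA2 (subset_trans sA1 sA).
- by apply: subset_trans sB2 (subset_trans sB1 sB).
move=> i a b; rewrite ltnS leq_eqVlt => /orP[/eqP ij aA bB|ij aA bB].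
  have -> : i = Ordinal jr by apply: val_inj.
  by have /exists_inPn/(_ b bB) := Hno a aA.
apply: Hn => //.
  by apply: (subsetP sA1); apply: (subsetP sA2).
by apply: (subsetP sB1); apply: (subsetP sB2).
Qed.

(** * Paths in good pairs *)

Lemma count_alternate (T : eqType) (e : rel T) (P : pred T) (p : seq T) :
  (forall x y, e x y -> ~~ (P x && P y)) -> sorted e p ->
  2 * count P p <= (size p).+1.
Proof.
move=> He; case: p => [//|x p] /= pp.
(* The summand [P x] for the head of the path makes the induction go through. *)
suff : 2 * count P (x :: p) <= size (x :: p) + P x by rewrite /=; case: (P x); lia.
elim: p x pp => [|y p IHp] x /=; first by case: (P x).
case/andP => /He exy /IHp /=.
by move: exy; case: (P x) (P y) => [] [] //=; lia.
Qed.

(* Depth-first search: [p] is the stack and [W] the set of abandoned vertices;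
   it is stopped when [W] first has [k] elements on one of the two sides. *)
Lemma linked_path (V : finType) (e : rel V) k (A B : {set V}) :
  symmetric e -> [disjoint A & B] -> linked e k A B ->
  exists p : seq V, [/\ uniq p, sorted e p, {subset p <= A :|: B}
    & 2 * minn #|A| #|B| <= size p + 4 * k + 1].
Proof.
move=> esym dAB /linkedP L.
have [small|] := leqP (minn #|A| #|B|) (2 * k).
  by exists [::]; split => //=; lia.
rewrite leq_min => /andP[kA kB].
(* Only edges between the two sides are followed, so the stack alternates between [A] and [B]. *)
pose e' a b := e a b && ((a \in A) && (b \in B) || (a \in B) && (b \in A)).
have e'sym : symmetric e'.
  by move=> a b; rewrite /e' esym orbC [_ && (b \in A)]andbC [_ && (b \in B)]andbC.
pose full (W : {set V}) := (#|W :&: A| == k) || (#|W :&: B| == k).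
pose state (p : seq V) (W : {set V}) :=
  [/\ [/\ uniq p, sorted e' p, {subset p <= A :|: B}, W \subset A :|: B
    & {in p, forall x, x \notin W}],
   (forall w u, w \in W -> u \in A :|: B -> u \notin W -> u \notin p -> ~~ e' w u),
   #|W :&: A| <= k & #|W :&: B| <= k].
have [p [W [[[up sp spAB sW pW] noe WA WB] fW]]] :
    exists p W, state p W /\ full W.
  (* Progress measure: pushing a vertex adds 1 to [2 * #|W| + size p]; abandoning one adds 2 and
     removes 1. The measure is at most [2 * #|A :|: B|], so the search stops. *)
  suff H j : exists p W, state p W /\ (full W \/ j <= 2 * #|W| + size p).
    have [p [W [[[up sp spAB sW pW] noe WA WB] [fW|big]]]] := H (2 * #|A :|: B|).+1.
      by exists p, W; split.
    have : #|W| + size p <= #|A :|: B|.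
      rewrite -(card_uniqP up) -(cardsE (mem p)) -cardsUI.
      have -> : W :&: [set x in p] = set0.
        apply/setP => x; rewrite !inE; apply/negP => /andP[xW xp].
        by have := pW x xp; rewrite xW.
      rewrite cards0 addn0; apply: subset_leq_card; rewrite subUset sW /=.
      by apply/subsetP => x; rewrite inE => /spAB.
    have : #|W| <= #|A :|: B| by apply: subset_leq_card.
    lia.
  elim: j => [|j [p [W [st [fW|jW]]]]].
  - exists [::], set0; split; last by right.
    by split; rewrite ?set0I ?cards0 //; [split => //; apply: sub0set | move=> w u; rewrite inE].
  - by exists p, W; split; [|left].
  have [fW|nfW] := boolP (full W); first by exists p, W; split; [|left].
  move: st => [[up sp spAB sW pW] noe WA WB].
  move: nfW; rewrite negb_or => /andP[nA nB].
  have {nA}WA' : #|W :&: A| < k by rewrite ltn_neqAle nA.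
  have {nB}WB' : #|W :&: B| < k by rewrite ltn_neqAle nB.
  case: p up sp spAB pW noe jW => [|x p] up sp spAB pW noe jW.
    have /subsetPn[u uA uW] : ~~ (A \subset W).
      apply/negP => /setIidPr AW; rewrite AW in WA; lia.
    exists [:: u], W; split; last by right; move: jW => /=; lia.
    split => //; first split => //.
    - by move=> y; rewrite inE => /eqP ->; rewrite inE uA.
    - by move=> y; rewrite inE => /eqP ->.
    by move=> w v wW vAB vW _; apply: noe.
  have [|] := boolP [exists u, [&& u \in A :|: B, u \notin W, u \notin x :: p & e' x u]].
    case/existsP => u /and4P[uAB uW up' xu].
    exists (u :: x :: p), W; split; last by right; move: jW => /=; lia.
    split => //; first split => //.
    - by rewrite cons_uniq up' up.
    - by rewrite /= e'sym xu.
    - by move=> y; rewrite inE => /predU1P[->//|/spAB].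
    - by move=> y; rewrite inE => /predU1P[->//|/pW].
    move=> w v wW vAB vW; rewrite in_cons negb_or => /andP[_]; exact: noe.
  move=> /existsPn Hx.
  have xW : x \notin W by apply: pW; rewrite mem_head.
  have xAB : x \in A :|: B by apply: spAB; rewrite mem_head.
  have leW (Z : {set V}) : #|W :&: Z| < k -> #|(x |: W) :&: Z| <= k.
    move=> lt; rewrite setIUl; apply: leq_trans (leq_card_setU _ _) _.
    have : #|[set x] :&: Z| <= 1 by rewrite -(cards1 x) subset_leq_card ?subsetIl.
    lia.
  exists p, (x |: W); split; last first.
    by right; rewrite cardsU1 xW; move: jW => /=; lia.
  split; [split| | |].
  - by case/andP: up.
  - exact: path_sorted sp.
  - by move=> y yp; apply: spAB; rewrite in_cons yp orbT.
  - by rewrite subUset sub1set xAB.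
  - move=> y yp; rewrite !inE negb_or pW ?in_cons ?yp ?orbT // andbT.
    by apply: contraTneq yp => ->; case/andP: up.
  - move=> w u; rewrite !inE => /predU1P[->|wW] uAB; rewrite negb_or => /andP[ux uW] unp.
      have := Hx u; rewrite uW in_cons negb_or ux unp inE uAB /=.
      by [].
    by apply: noe; rewrite ?inE ?negb_or ?ux.
  - exact: leW.
  - exact: leW.
have [spe cnt] : sorted e p /\ forall Z : {set V},
    (forall x y, e' x y -> ~~ ((x \in Z) && (y \in Z))) ->
    2 * count (mem Z) p <= (size p).+1.
  split; first by apply: sub_sorted sp => x y /andP[].
  by move=> Z HZ; apply: count_alternate sp.
have AnB x : x \in A -> x \in B = false.
  by move=> xA; rewrite (disjointFr dAB).
(* [Y] is the side on which [W] has [k] elements. Fewer than [k] vertices of [Z] lie outside [W] and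
   [p], since otherwise an edge would lead to them from [W]; at most [k] lie in [W], and at most
   half of [p], rounded up, is in [Z]. *)
have main (Z Y : {set V}) : Z \subset A :|: B ->
    (forall x y, e' x y -> ~~ ((x \in Z) && (y \in Z))) ->
    (forall Y' Z' : {set V}, Y' \subset Y -> Z' \subset Z -> k <= #|Y'| -> k <= #|Z'| ->
             exists a b, [/\ a \in Y', b \in Z' & e' a b]) ->
    #|W :&: Y| = k -> #|W :&: Z| <= k -> 2 * #|Z| <= size p + 4 * k + 1.
  move=> sZ aZ HL WY WZ.
  have small : #|Z :\: W :\: [set x in p]| < k.
    rewrite ltnNge; apply/negP => kZ.
    have sZ' : Z :\: W :\: [set x in p] \subset Z.
      by apply/subsetP => x; rewrite !inE => /and3P[].
    have [a [b []]] := HL (W :&: Y) _ (subsetIr _ _) sZ' (eq_leq (Logic.eq_sym WY)) kZ.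
    rewrite !inE => /andP[aW aY] /and3P[bp bW bZ]; apply/negP.
    by apply: noe => //; apply: (subsetP sZ).
  have cp : #|Z :&: [set x in p]| <= count (mem Z) p.
    rewrite -size_filter -(card_uniqP (filter_uniq _ up)).
    apply: subset_leq_card; apply/subsetP => x.
    by rewrite !inE mem_filter.
  have := cnt Z aZ.
  have c1 := cardsID W Z; have c2 := cardsID [set x in p] (Z :\: W).
  have : #|(Z :\: W) :&: [set x in p]| <= #|Z :&: [set x in p]|.
    by apply: subset_leq_card; apply: setSI; apply: subsetDl.
  rewrite setIC in WZ; lia.
exists p; split => //.
case/orP: fW => /eqP fW.
  apply: leq_trans (main B A _ _ _ fW WB); rewrite ?subsetUr //.
  - by rewrite leq_mul2l geq_minr.
  - move=> x y /andP[_ /orP[]/andP[xA yA]]; apply/negP => /andP[].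
      by rewrite (AnB _ xA).
    by rewrite (AnB _ yA).
  move=> A' B' sA sB cA cB; have [a [b [aA bB eab]]] := L _ _ sA sB cA cB.
  by exists a, b; split => //; rewrite /e' eab (subsetP sA) // (subsetP sB).
apply: leq_trans (main A B _ _ _ fW WA); rewrite ?subsetUl //.
- by rewrite leq_mul2l geq_minl.
- move=> x y /andP[_ /orP[]/andP[xA yA]]; apply/negP => /andP[].
    by move=> _ /AnB; rewrite yA.
  by move=> /AnB; rewrite xA.
move=> B' A' sB sA cB cA; have [a [b [aA bB eab]]] := L _ _ sA sB cA cB.
exists b, a; split => //; rewrite /e' esym eab /=.
by rewrite (subsetP sA _ aA) (subsetP sB _ bB) orbT.
Qed.

(** * Joining disjoint paths *)

(** The flaws of a path: missing edges or edges outside one colour, according to [f]. *)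
Definition defects (T : Type) (f : rel T) (p : seq T) : nat :=
  if p is x :: s then count id (pairmap f x s) else 0.

Lemma sorted_defects (T : Type) (e : rel T) p :
  sorted e p = (defects (fun x y => ~~ e x y) p == 0).
Proof.
case: p => [//|x p] /=.
by elim: p x => [//|y p IHp] x /=; rewrite IHp; case: (e x y).
Qed.

Lemma defects_cat (T : Type) (f : rel T) p a b q :
  defects f (rcons p a ++ b :: q) = defects f (rcons p a) + f a b + defects f (b :: q).
Proof.
case: p => [|x p] /=; first by rewrite add0n.
by rewrite pairmap_cat count_cat /= last_rcons addnA.
Qed.

Lemma defects_catr (T : Type) (f : rel T) p q : defects f q <= defects f (p ++ q).
Proof.
case: p => [//|x p]; case: q => [//|y q] /=.
by rewrite pairmap_cat count_cat /=; lia.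
Qed.

Lemma defects_rcons_cat (T : Type) (f : rel T) p a q :
  defects f (rcons p a) <= defects f (rcons p a ++ q).
Proof.
case: q => [|b q]; first by rewrite cats0.
by rewrite defects_cat -addnA leq_addr.
Qed.

(** Two paths are joined by an edge of [e] between the last [u] vertices of one and the first [u] of
    the other, at the cost of fewer than [2 * u] vertices and at most one defect. Paths with at most
    [2 * u] vertices count as 0 in the sum and are dropped. *)
Lemma link_paths (V : finType) (e f : rel V) u (ps : seq (seq V)) :
  (forall X Y : {set V}, [disjoint X & Y] -> u <= #|X| -> u <= #|Y| ->
     exists a b, [/\ a \in X, b \in Y & e a b]) ->
  {in ps, forall p, sorted e p /\ defects f p = 0} -> uniq (flatten ps) ->
  exists q : seq V, [/\ uniq q, sorted e q, {subset q <= flatten ps},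
    defects f q <= size ps & \sum_(l <- map size ps) (l - 2 * u) <= size q].
Proof.
move=> He; elim: ps => [|p ps IHps] Hps; first by exists [::]; rewrite big_nil.
rewrite /= cat_uniq => /and3P[up dis uf].
have [q [uq sq subq dq szq]] : exists q : seq V, [/\ uniq q, sorted e q, {subset q <= flatten ps},
    defects f q <= size ps & \sum_(l <- map size ps) (l - 2 * u) <= size q].
  by apply: IHps => // y yps; apply: Hps; rewrite in_cons yps orbT.
have [sp dp] := Hps p (mem_head _ _).
rewrite /= big_cons; move: (\sum_(_ <- _) _) szq => S szq.
have [psmall|pbig] := leqP (size p) (2 * u).
  exists q; split => //; last by lia.
    by move=> x /subq; rewrite mem_cat orbC => ->.
  exact: leqW.
(* If [q] is short, the sum over the other paths is at most [2 * u], so [p] alone is long enough. *)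
have [qsmall|qbig] := leqP (size q) (2 * u).
  exists p; split => //; last by lia.
    by move=> x; rewrite mem_cat => ->.
  by rewrite dp.
have pq x : x \in p -> x \notin q.
  move=> xp; apply/negP => /subq xf; move/hasPn: dis => /(_ x xf).
  by rewrite xp.
have [a [b []]] : exists a b, [/\ a \in [set x in drop (size p - u) p],
    b \in [set x in take u q] & e a b].
  apply: He.
  - rewrite -setI_eq0; apply/eqP/setP => x; rewrite !inE.
    by apply/negP => /andP[/mem_drop/pq xq /mem_take]; apply/negP.
  - rewrite cardsE (card_uniqP _) ?drop_uniq // size_drop; lia.
  - rewrite cardsE (card_uniqP _) ?take_uniq // size_takel; lia.
rewrite !inE => ap bq eab.
have [p1 [p2 [Ep szp]]] : exists p1 p2, p = rcons p1 a ++ p2 /\ size p2 < u.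
  case/splitPr Ed : _ / ap => [d1 d2].
  exists (take (size p - u) p ++ d1), d2; split.
    by rewrite cat_rcons -catA -Ed cat_take_drop.
  have := congr1 size Ed; rewrite size_drop size_cat /=; lia.
have [q1 [q2 [Eq szq1]]] : exists q1 q2, q = q1 ++ b :: q2 /\ size q1 < u.
  case/splitPr Ed : _ / bq => [d1 d2].
  exists d1, (d2 ++ drop u q); split.
    by rewrite -cat_cons catA -Ed cat_take_drop.
  have := congr1 size Ed; rewrite size_takel ?size_cat /=; lia.
have sub1 : {subset rcons p1 a <= p} by move=> x xp; rewrite Ep mem_cat xp.
have sub2 : {subset b :: q2 <= q} by move=> x xp; rewrite Eq mem_cat xp orbT.
exists (rcons p1 a ++ b :: q2); split.
- rewrite cat_uniq; apply/and3P; split.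
  + by move: up; rewrite Ep cat_uniq => /and3P[].
  + by apply/hasPn => x /sub2 xq; apply: contraL xq => /sub1; apply: pq.
  + by move: uq; rewrite Eq cat_uniq => /and3P[].
- move: sp sq; rewrite !sorted_defects defects_cat eab addn0 => /eqP sp /eqP sq.
  have := defects_rcons_cat (fun x y => ~~ e x y) p1 a p2.
  have := defects_catr (fun x y => ~~ e x y) q1 (b :: q2).
  by rewrite -Ep -Eq sp sq; lia.
- by move=> x; rewrite !mem_cat => /orP[/sub1 -> //|/sub2/subq ->]; rewrite orbT.
- have := defects_rcons_cat f p1 a p2; have := defects_catr f q1 (b :: q2).
  rewrite -Ep -Eq dp defects_cat /=; case: (f a b); lia.
- have := congr1 size Ep; have := congr1 size Eq.
  by rewrite !size_cat /=; lia.
Qed.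

(** * Fractional packings and covers *)

(** The load of [v]. Blocks may repeat in the list [s], which thus encodes a scaled fractional
    packing. *)
Definition cnt (V I : finType) (b : I -> {set V}) (s : seq I) (v : V) : nat :=
  count (fun t => v \in b t) s.

Lemma sum_cnt (V I : finType) (b : I -> {set V}) (s : seq I) (F : V -> nat) :
  \sum_(t <- s) \sum_(v in b t) F v = \sum_v cnt b s v * F v.
Proof.
elim: s => [|t s IHs].
  by rewrite big_nil big1.
rewrite big_cons IHs big_mkcond -big_split /=; apply: eq_bigr => v _.
by rewrite /cnt /=; case: (v \in b t); lia.
Qed.

(* The additive constant keeps the subtraction from being truncated. *)
Definition loss (c0 N c : nat) : nat :=
  N * (c0 + N) + \sum_(j < c) (j - c0) - N * c.

(** The discrete derivative of the loss: one more use of a vertex is rewarded by [N] and charged the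
    excess of its load over [c0]. *)
Lemma lossS c0 N c : loss c0 N c.+1 + N = loss c0 N c + (c - c0).
Proof.
(* No truncation occurs: up to [c0 + N] uses the constant term suffices, and beyond that each new
   summand is at least [N]. *)
have H k : N * k <= N * (c0 + N) + \sum_(j < k) (j - c0).
  elim: k => [|k IHk]; first by rewrite muln0.
  rewrite big_ord_recr /=; have [kle|kgt] := leqP k.+1 (c0 + N).
    by apply: leq_trans (leq_addr _ _); rewrite leq_mul2l kle orbT.
  by move: (\sum_(_ < k) _) IHk => S IHk; rewrite mulnS; lia.
have := H c; have := H c.+1; rewrite /loss big_ord_recr /=.
by move: (\sum_(_ < c) _) => S; lia.
Qed.

(* A local minimum of the total loss: [g v = cnt v - c0] is the price of using
   [v] once more, and the two conditions state that neither adding nor removing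
   a single block is profitable (the latter summed over all used blocks). *)
Lemma packing (c0 N : nat) (V I : finType) (good : pred I) (b : I -> {set V}) :
  exists s : seq I,
    [/\ all good s,
        forall t, good t -> N * #|b t| <= \sum_(v in b t) (cnt b s v - c0)
      & \sum_v cnt b s v * ((cnt b s v).-1 - c0) <= N * \sum_v cnt b s v].
Proof.
pose Lo s := \sum_v loss c0 N (cnt b s v).
have addE t s : Lo (t :: s) + N * #|b t| = Lo s + \sum_(v in b t) (cnt b s v - c0).
  rewrite -sum1_card big_distrr /= [X in _ + X]big_mkcond [X in _ = _ + X]big_mkcond.
  rewrite -!big_split /=; apply: eq_bigr => v _; rewrite muln1 /cnt /=.
  by case: (v \in b t); rewrite ?addn0 // add1n lossS.
(* Descent on the natural number [Lo s], starting from the empty packing. *)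
suff H k s : all good s -> Lo s < k -> exists s : seq I,
    [/\ all good s,
        forall t, good t -> N * #|b t| <= \sum_(v in b t) (cnt b s v - c0)
      & \sum_v cnt b s v * ((cnt b s v).-1 - c0) <= N * \sum_v cnt b s v].
  by apply: (H (Lo [::]).+1 [::]).
elim: k s => [//|k IHk] s gs; rewrite ltnS => Lk.
have [/existsP[t /andP[gt lt]]|/existsPn noadd] :=
    boolP [exists t, good t && (Lo (t :: s) < Lo s)].
  by apply: (IHk (t :: s)); [rewrite /= gt | apply: leq_trans lt Lk].
have [/hasP[t ts lt]|/hasPn norem] := boolP (has (fun t => Lo (rem t s) < Lo s) s).
  apply: (IHk (rem t s)); last exact: leq_trans lt Lk.
  by apply/allP => x /mem_rem; apply: (allP gs).
exists s; split => // [t gt|].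
  have := noadd t; rewrite gt /= -leqNgt; have := addE t s.
  by move: (Lo (t :: s)) (Lo s) (\sum_(v in b t) _) => x y z; lia.
(* Removing [t] lowers each load on its block by one, hence the predecessor in the price. *)
have step t : t \in s -> \sum_(v in b t) ((cnt b s v).-1 - c0) <= N * #|b t|.
  move=> ts; have := norem t ts; rewrite -leqNgt.
  have cE v : cnt b s v = cnt b (t :: rem t s) v.
    by apply/permP; apply: perm_to_rem.
  have -> : Lo s = Lo (t :: rem t s) by apply: eq_bigr => v _; rewrite cE.
  have -> : \sum_(v in b t) ((cnt b s v).-1 - c0) = \sum_(v in b t) (cnt b (rem t s) v - c0).
    by apply: eq_bigr => v vt; rewrite cE /cnt /= vt.
  have := addE t (rem t s).
  by move: (Lo _) (Lo _) (\sum_(v in b t) _) => x y z; lia.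
rewrite -sum_cnt; under [X in N * X]eq_bigr do rewrite -[cnt _ _ _]muln1.
rewrite -sum_cnt big_distrr /=; rewrite !big_seq; apply: leq_sum => t /step.
by rewrite sum1_card.
Qed.

(** Label by position modulo [D]: each residue occurs at least [#|X| %/ D] times. *)
Lemma equitable_labelling (V : finType) (X : {set V}) D : 0 < D ->
  exists l : V -> nat, forall j, j < D -> #|X| <= D * #|[set v in X | l v == j]|.+1.
Proof.
move=> D0; exists (fun v => index v (enum X) %% D) => j jD.
have [/eqP->//|/set0Pn[v0 _]] := boolP (X == set0); first by rewrite cards0.
pose f (k : 'I_(#|X| %/ D)) := nth v0 (enum X) (k * D + j).
have fsz (k : 'I_(#|X| %/ D)) : k * D + j < size (enum X).
  rewrite -cardE; apply: leq_trans (leq_trunc_div #|X| D).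
  by apply: (@leq_trans (k.+1 * D)); [rewrite mulSn; lia | rewrite leq_mul2r ltn_ord orbT].
have : #|'I_(#|X| %/ D)| <= #|[set v in X | index v (enum X) %% D == j]|.
  rewrite -(@card_imset _ _ f); last first.
    move=> k k' /eqP; rewrite /f nth_uniq ?fsz ?enum_uniq //.
    by rewrite eqn_add2r eqn_pmul2r // => /eqP/val_inj.
  apply: subset_leq_card; apply/subsetP => v /imsetP[k _ ->].
  rewrite inE /f index_uniq ?fsz ?enum_uniq // modnMDl modn_small // eqxx andbT.
  by rewrite -mem_enum mem_nth.
rewrite card_ord => H.
apply: (@leq_trans (D * (#|X| %/ D).+1)); last by rewrite leq_mul2l ltnS H orbT.
by rewrite mulnC ltnW // ltn_ceil.
Qed.

(* Every class of vertices lying in the same members of the family is divided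
   evenly into [D] parts, which are then given to distinct members. *)
Lemma disjoint_shrinking (V J : finType) (Z : J -> {set V}) D : 0 < D ->
  exists Z' : J -> {set V},
    [/\ forall j, Z' j \subset Z j,
        forall i j, i != j -> [disjoint Z' i & Z' j]
      & forall j, #|[set v in Z j | #|[set i | v \in Z i]| <= D]|
                  <= D * (#|Z' j| + 2 ^ #|J|)].
Proof.
move=> D0; pose at_ v := [set i | v \in Z i].
have [l Hl] : exists l : {set J} -> V -> nat, forall F j, j < D ->
    #|[set v | at_ v == F]| <= D * #|[set v in [set v | at_ v == F] | l F v == j]|.+1.
  have [l Hl] := @fin_all_exists _ _ (fun F l => forall j, j < D ->
     #|[set v | at_ v == F]| <= D * #|[set v in [set v | at_ v == F] | l v == j]|.+1)
     (fun F => equitable_labelling [set v | at_ v == F] D0).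
  by exists l.
(* The label of [v] selects by rank one of the members containing it; if none has that rank, [v] is
   left out. *)
pose Z' j := [set v in Z j | (#|at_ v| <= D) && (l (at_ v) v == index j (enum (at_ v)))].
exists Z'; split.
- by move=> j; apply/subsetP => v; rewrite inE => /andP[].
- move=> i j ij; rewrite -setI_eq0; apply/eqP/setP => v; rewrite !inE.
  apply/negP => /andP[/and3P[vi _ /eqP->] /and3P[vj _ /eqP E]].
  have mi : i \in enum (at_ v) by rewrite mem_enum inE.
  have mj : j \in enum (at_ v) by rewrite mem_enum inE.
  by move/eqP: ij; apply; rewrite -(nth_index i mi) E nth_index.
move=> j.
have dec (P : pred V) : #|[set v | P v]| = \sum_(F : {set J}) #|[set v in [set v | at_ v == F] | P v]|.
  rewrite -sum1_card (partition_big at_ predT) //=; apply: eq_bigr => F _.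
  by rewrite -sum1_card; apply: eq_bigl => v; rewrite !inE andbC.
(* The bound is proved class by class; each of the [2 ^ #|J|] classes loses at most [D] to
   rounding. *)
rewrite dec [#|Z' j|]dec mulnDr [D * \sum_(_ | _) _]big_distrr /=.
have -> : D * 2 ^ #|J| = \sum_(F : {set J}) D.
  by rewrite sum_nat_const mulnC -(cardsT {set J}) -powersetT card_powerset cardsT.
rewrite -big_split /=; apply: leq_sum => F _.
have [/andP[jF FD]|no] := boolP ((j \in F) && (#|F| <= D)); last first.
  rewrite (_ : [set v in _ | _] = set0) ?cards0 //; apply/setP => v; rewrite !inE.
  apply/negP => /andP[/eqP E /andP[vj cD]]; move/negP: no; apply.
  by rewrite -E inE vj cD.
have ilt : index j (enum F) < D.
  by apply: leq_trans FD; rewrite cardE index_mem mem_enum.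
have := Hl F _ ilt; rewrite -mulnSr => H.
apply: leq_trans (leq_trans H _).
  by apply: subset_leq_card; apply/subsetP => v; rewrite !inE => /andP[].
rewrite leq_mul2l ltnS; apply/orP; right.
apply: subset_leq_card; apply/subsetP => v; rewrite !inE => /andP[/eqP E lv].
by rewrite E lv FD eqxx /= andbT; move: jF; rewrite -E inE.
Qed.

(* Half-integrality of fractional vertex covers: for a threshold [th], the
   function [h] is rounded to [th <= h] + [2N - th < h], which is in {0, 1, 2}. *)
Definition rounding (N th x : nat) : nat := (th <= x) + (2 * N < th + x).

Lemma rounding_cover N th x y : th <= N -> 2 * N <= x + y ->
  2 <= rounding N th x + rounding N th y.
Proof.
rewrite /rounding => H1 H2.
by case: leqP; case: leqP; case: leqP; case: leqP; lia.
Qed.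

(** Counting thresholds, the first indicator contributes [minn x N] and the second the part of [x]
    between [N] and [2 * N]. *)
Lemma sum_rounding N x : \sum_(1 <= th < N.+1) rounding N th x <= x.
Proof.
suff -> : \sum_(1 <= th < N.+1) rounding N th x = minn x (2 * N) by apply: geq_minl.
suff H k : k <= N -> \sum_(1 <= th < k.+1) rounding N th x
    = minn x k + (minn x (2 * N) - (2 * N - k)).
  by rewrite H //; lia.
elim: k => [|k IHk] kN; first by rewrite big_geq //; lia.
rewrite big_nat_recr //= IHk ?(ltnW kN) // /rounding.
by case: leqP; case: leqP; lia.
Qed.

(** Some threshold does no worse than the average over 1 to [N]. *)
Lemma threshold_exists (V : finType) N (h : V -> nat) : 0 < N ->
  exists2 th, th <= N & N * \sum_v rounding N th (h v) <= \sum_v h v.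
Proof.
move=> N0.
have H : \sum_(1 <= th < N.+1) \sum_v rounding N th (h v) <= \sum_v h v.
  by rewrite exchange_big /=; apply: leq_sum => v _; apply: sum_rounding.
have [/existsP[th le]|/existsPn no] :=
    boolP [exists th : 'I_N, N * \sum_v rounding N th.+1 (h v) <= \sum_v h v].
  by exists th.+1; rewrite // ltn_ord.
have : N * (\sum_v h v).+1 <= N * \sum_(1 <= th < N.+1) \sum_v rounding N th (h v).
  rewrite big_add1 big_mkord /= big_distrr /= -{1}[N]card_ord -sum_nat_const.
  by apply: leq_sum => th _; have := no th; rewrite -ltnNge.
by rewrite leq_pmul2l // ltnNge H.
Qed.

(** All frequent vectors [g] of rounded values satisfy [2 <= \sum_i g i + g j] for one fixed [j].
    Summing over vertices, the [r] cover weights with the one for [j] repeated are [r.+1] numbers,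
    one of which reaches the average. The error term counts the vertices with rare vectors. *)
Lemma cover_bound (V : finType) r N m (h : 'I_r -> V -> nat) : 0 < r -> 0 < N ->
  (forall X Y : {set V}, [disjoint X & Y] -> m <= #|X| -> m <= #|Y| ->
     exists i a b, [/\ a \in X, b \in Y & 2 * N <= h i a + h i b]) ->
  exists i, 2 * N * #|V| <= r.+1 * (\sum_v h i v) + 2 * N * (3 ^ r * (2 * m)).
Proof.
move=> r0 N0 Hh.
have [th thN thS] := fin_all_exists2 (fun i => threshold_exists (h i) N0).
have r3 i v : rounding N (th i) (h i v) < 3.
  by rewrite ltnS (leq_trans (leq_add (leq_b1 _) (leq_b1 _))).
pose rho v : {ffun 'I_r -> 'I_3} := [ffun i => Ordinal (r3 i v)].
pose class f := [set v | rho v == f].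
pose big f := 2 * m <= #|class f|.
have bigbig f g : big f -> big g -> exists i, 2 <= f i + g i.
  move=> bf bg.
  have [X [Y [dXY mX mY sX sY]]] : exists X Y : {set V},
      [/\ [disjoint X & Y], m <= #|X|, m <= #|Y|, X \subset class f & Y \subset class g].
    (* A class compared with itself is split in two, which is why frequent means at least [2 * m]
       vertices. *)
    have [<-|fg] := eqVneq f g.
      have [X sX cX] : exists2 X : {set V}, X \subset class f & #|X| = m.
        by apply: exists_subset; apply: leq_trans bf; lia.
      exists X, (class f :\: X); rewrite cX leqnn sX subsetDl; split => //.
        by rewrite -setI_eq0 setDE setICA setICr setI0.
      by have := cardsD (class f) X; rewrite (setIidPr sX) cX => ->; move: bf; rewrite /big; lia.
    exists (class f), (class g); split => //.
    - rewrite -setI_eq0; apply/eqP/setP => v; rewrite !inE.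
      by apply/negP => /andP[/eqP-> /eqP E]; rewrite E eqxx in fg.
    - by apply: leq_trans bf; lia.
    - by apply: leq_trans bg; lia.
  have [i [a [b [aX bY hab]]]] := Hh X Y dXY mX mY.
  exists i; have := subsetP sX a aX; have := subsetP sY b bY.
  rewrite !inE => /eqP <- /eqP <-; rewrite !ffunE /=.
  by apply: rounding_cover (thN i) hab.
(* A frequent vector with sum at most 1, compared with itself, is a unit vector; [j] is its support.
   Every frequent [g] then has [g j >= 1] or an entry 2 elsewhere. If there is no such vector, all
   sums are at least 2 and any [j] will do. *)
have [j Hj] : exists j, forall g, big g -> 2 <= \sum_i g i + g j.
  have [/existsP[f /andP[bf f1]]|/existsPn no] :=
      boolP [exists f : {ffun 'I_r -> 'I_3}, big f && (\sum_i f i <= 1)].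
    have [j fj] := bigbig _ _ bf bf.
    have {}fj : 0 < f j by move: fj; case: (nat_of_ord (f j)).
    have f0 i : i != j -> f i = 0 :> nat.
      move=> ij; move: f1 fj; rewrite (bigD1 j) //= (bigD1 i) //=.
      by case: (nat_of_ord (f j)) (nat_of_ord (f i)) => [|[|?]] [|?].
    have fj1 : f j = 1 :> nat.
      by move: f1 fj; rewrite (bigD1 j) //=; case: (nat_of_ord (f j)) => [|[|?]].
    exists j => g bg; have [i fg] := bigbig _ _ bf bg.
    have [ij|ij] := eqVneq i j.
      move: fg; rewrite ij fj1 (bigD1 j) //=.
      by move: (nat_of_ord (g j)) (\sum_(_ < r | _) _) => x y; lia.
    have g2 : 2 <= g i by move: fg; rewrite f0.
    rewrite (bigD1 i) //= -addnA; exact: leq_trans g2 (leq_addr _ _).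
  by exists (Ordinal r0) => g bg; have := no g; rewrite bg -ltnNge /= => /leq_trans; apply; rewrite leq_addr.
pose W := [set v | big (rho v)].
have VW : #|V| <= #|W| + 3 ^ r * (2 * m).
  rewrite -cardsT -(cardsID W setT) setTI leq_add2l.
  rewrite -sum1_card (partition_big rho predT) //=.
  have -> : 3 ^ r * (2 * m) = \sum_(f : {ffun 'I_r -> 'I_3}) 2 * m.
    by rewrite sum_nat_const card_ffun !card_ord.
  apply: leq_sum => f _; have [bf|nbf] := boolP (big f).
    rewrite big_pred0 // => v; rewrite !inE andbT.
    by apply/negP => /andP[bv /eqP E]; rewrite E bf in bv.
  rewrite -ltnNge in nbf; apply: leq_trans (ltnW nbf); rewrite sum1_card.
  by apply: subset_leq_card; apply/subsetP => v; rewrite !inE => /andP[_ /eqP->].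
pose S i := \sum_v rho v i.
have SW : 2 * #|W| <= \sum_i S i + S j.
  rewrite exchange_big -big_split /= -sum1_card big_distrr big_mkcond /=.
  by apply: leq_sum => v _; rewrite inE; case: ifP => // /Hj.
apply/existsP; apply: contraT => /existsPn no.
have Sno i : r.+1 * S i < 2 * #|W|.
  have := no i; rewrite -ltnNge => lt.
  have le := thS i.
  have SE : S i = \sum_v rounding N (th i) (h i v).
    by apply: eq_bigr => v _; rewrite ffunE.
  rewrite -SE in le; rewrite -(ltn_pmul2l N0).
  move: (\sum_v h i v) lt le => H lt le.
  have : N * #|V| <= N * (#|W| + 3 ^ r * (2 * m)) by rewrite leq_mul2l VW orbT.
  have : r.+1 * (N * S i) <= r.+1 * H by rewrite leq_mul2l le orbT.
  by move: (S i) (3 ^ r * (2 * m)) lt => s x; nia.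
have : \sum_i r.+1 * S i <= \sum_(i < r) (2 * #|W|).
  by apply: leq_sum => i _; apply: ltnW.
rewrite -big_distrr sum_nat_const card_ord /=.
have := Sno j; have : r.+1 * (2 * #|W|) <= r.+1 * (\sum_i S i + S j).
  by rewrite leq_mul2l SW orbT.
by move: (\sum_i S i) (S j) => x y; nia.
Qed.

(** * From packings to paths *)

Lemma uniq_flatten_map (I T : eqType) (p : I -> seq T) (r : seq I) : uniq r ->
  (forall i, uniq (p i)) ->
  (forall i j x, i != j -> x \in p i -> x \notin p j) ->
  uniq (flatten [seq p i | i <- r]).
Proof.
move=> + up dp; elim: r => [//|i r IHr] /= /andP[ir /IHr ur].
rewrite cat_uniq up ur andbT /=; apply/hasPn => x /flattenP[_ /mapP[j jr ->] xj].
by apply: dp xj; apply: contraNneq ir => <-.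
Qed.

Definition good_pair (V : finType) (e : rel V) (m k : nat) (t : {set V} * {set V}) : bool :=
  [&& [disjoint t.1 & t.2], #|t.1| == m, #|t.2| == m & linked e k t.1 t.2].

Definition pair_block (V : finType) (t : {set V} * {set V}) : {set V} := t.1 :|: t.2.

(** Shrink the sides of the pairs to disjoint sets, losing a factor [D], find a long path in each
    shrunk pair, and join these paths. Vertices of load above [D] may be lost, and count twice
    because a path is limited by the smaller side of its pair. *)
Lemma packing_path (V : finType) (eG e : rel V) m k u D (s : seq ({set V} * {set V})) :
  symmetric e -> subrel e eG ->
  (forall X Y : {set V}, [disjoint X & Y] -> u <= #|X| -> u <= #|Y| ->
     exists a b, [/\ a \in X, b \in Y & eG a b]) ->
  all (good_pair e m k) s -> 0 < D ->
  let c := cnt (@pair_block V) s in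
  exists q : seq V, [/\ uniq q, sorted eG q,
    defects (fun x y => ~~ e x y) q <= size s &
    \sum_v c v <= 2 * (\sum_(v | D < c v) c v)
      + D * (size q + size s * (4 * k + 1 + 2 * u + 2 * 2 ^ (size s * 2)))].
Proof.
move=> esym eeG HG gs D0 c; set T := size s.
pose t_ (i : 'I_T) := tnth (in_tuple s) i.
have gt i : good_pair e m k (t_ i) by apply: (allP gs); apply: mem_tnth.
(* The two sides of a pair are separate members; being disjoint, they make [v] lie in exactly [c v]
   members. *)
pose Z (j : 'I_T * bool) := if j.2 then (t_ j.1).1 else (t_ j.1).2.
have [Z' [sZ dZ cZ]] := disjoint_shrinking Z D0.
have dt i v : (v \in (t_ i).1) && (v \in (t_ i).2) = false.
  case/and4P: (gt i) => + _ _ _; case: (boolP (v \in _)) => //= v1.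
  by move=> d; rewrite (disjointFr d v1).
have cE v : #|[set j | v \in Z j]| = c v.
  transitivity (\sum_(i < T) \sum_(b : bool) nat_of_bool (v \in Z (i, b))).
    rewrite pair_big -sum1_card big_mkcond /=.
    by apply: eq_bigr => -[i b] _; rewrite inE; case: (_ \in _).
  rewrite /c /cnt -sum1_count (big_tnth _ _ s) [RHS]big_mkcond /=.
  apply: eq_bigr => i _; rewrite big_bool /Z /pair_block /= inE -/(t_ i).
  by have := dt i v; case: (_ \in _); case: (_ \in _).
have cJ : #|{: 'I_T * bool}| = T * 2 by rewrite card_prod card_ord card_bool.
set X := 2 ^ (T * 2); pose O := [set v | D < c v].
have Hp i : exists p : seq V, [/\ uniq p, sorted e p, {subset p <= Z' (i, true) :|: Z' (i, false)}
    & 2 * minn #|Z' (i, true)| #|Z' (i, false)| <= size p + 4 * k + 1].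
  apply: linked_path => //; first by apply: dZ; rewrite xpair_eqE andbF.
  by case/and4P: (gt i) => _ _ _; apply: linkedS; apply: sZ.
have [p Hp'] := fin_all_exists Hp.
have up i : uniq (p i) by case: (Hp' i).
have sp i : sorted e (p i) by case: (Hp' i).
have [||| q [uq sq _ dq szq]] := @link_paths V eG (fun x y => ~~ e x y) u [seq p i | i <- enum 'I_T].
- exact: HG.
- move=> _ /mapP[i _ ->]; split; first exact: sub_sorted (sp i).
  by apply/eqP; rewrite -sorted_defects.
- apply: uniq_flatten_map => //; first exact: enum_uniq.
  move=> i j x ij xi; apply/negP => xj.
  case: (Hp' i) (Hp' j) => _ _ /(_ x xi) + _ [_ _ /(_ x xj) + _].
  rewrite !inE; have dis b b' : (x \in Z' (i, b)) -> (x \in Z' (j, b')) -> False.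
    move=> xi' xj'; have /disjointFr/(_ xi') : [disjoint Z' (i, b) & Z' (j, b')].
      by apply: dZ; rewrite xpair_eqE negb_and ij.
    by rewrite xj'.
  by move=> /orP[] + /orP[]; apply: dis.
exists q; split => //.
  by move: dq; rewrite size_map size_enum_ord.
have step i : 2 * m <= D * (size (p i) + 4 * k + 1 + 2 * X) + 2 * #|pair_block (t_ i) :&: O|.
  have [_ _ _] := Hp' i; have := cZ (i, true); have := cZ (i, false); rewrite cJ -/X /Z /=.
  case/and4P: (gt i) => _ /eqP c1 /eqP c2 _.
  have low (A : {set V}) z : #|A| = m -> A \subset pair_block (t_ i) ->
     #|[set v in A | #|[set i0 | v \in Z i0]| <= D]| <= D * (z + X) ->
     m <= D * (z + X) + #|pair_block (t_ i) :&: O|.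
    move=> <- sA H; rewrite -(cardsID O A) [X in X <= _]addnC; apply: leq_add.
      apply: leq_trans H; apply: subset_leq_card; apply/subsetP => v.
      by rewrite /O !inE cE -leqNgt andbC.
    by apply: subset_leq_card; apply: setSI.
  move=> /(low _ _ c2 (subsetUr _ _)) h2 /(low _ _ c1 (subsetUl _ _)) h1 hm.
  have : m <= D * (minn #|Z' (i, true)| #|Z' (i, false)| + X) + #|pair_block (t_ i) :&: O|.
    by rewrite /minn; case: ifP.
  move: (minn _ _) hm #|_ :&: O| => z hm o hz.
  have : D * (2 * z) <= D * (size (p i) + 4 * k + 1) by rewrite leq_mul2l hm orbT.
  by move: (size _) => l; lia.
have blockE (F : V -> nat) : \sum_v c v * F v = \sum_i \sum_(v in pair_block (t_ i)) F v.
  by rewrite -sum_cnt (big_tnth _ _ s).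
have -> : \sum_v c v = \sum_(i < T) 2 * m.
  under eq_bigr do rewrite -[c _]muln1.
  rewrite blockE; apply: eq_bigr => i _; rewrite sum1_card.
  case/and4P: (gt i) => d /eqP c1 /eqP c2 _.
  by rewrite /pair_block cardsU disjoint_setI0 // cards0 subn0 c1 c2 mul2n addnn.
have OE : \sum_(v | D < c v) c v = \sum_i #|pair_block (t_ i) :&: O|.
  rewrite big_mkcond; under eq_bigr => v _.
    have -> : (if D < c v then c v else 0) = c v * (v \in O).
      by rewrite /O inE; case: ifP; rewrite (muln1, muln0).
    over.
  rewrite blockE; apply: eq_bigr => i _.
  rewrite -sum1_card [in RHS]big_mkcond [LHS]big_mkcond; apply: eq_bigr => v _.
  by rewrite /O !inE; case: (_ || _) => //=; case: (D < c v).
apply: (@leq_trans (\sum_(i < T) (D * (size (p i) + 4 * k + 1 + 2 * X)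
    + 2 * #|pair_block (t_ i) :&: O|))); first by apply: leq_sum => i _; apply: step.
rewrite big_split -!big_distrr /= -OE addnC leq_add2l leq_mul2l; apply/orP; right.
have : \sum_i size (p i) <= size q + T * (2 * u).
  apply: (@leq_trans (\sum_i (size (p i) - 2 * u) + \sum_(i < T) 2 * u)).
    by rewrite -big_split /=; apply: leq_sum => i _; lia.
  rewrite sum_nat_const card_ord leq_add2r; apply: leq_trans szq.
  by rewrite !big_map -big_enum.
rewrite !big_split /= !sum_nat_const card_ord; move: (\sum_i _) => l; clear.
by rewrite !mulnDr; lia.
Qed.

Lemma defects_le (T : Type) (f g : rel T) p : subrel f g -> defects f p <= defects g p.
Proof.
move=> fg; case: p => [//|x p] /=; elim: p x => [//|y p IHp] x /=.
by apply: leq_add (IHp y); case E: (f x y) => //; rewrite (fg _ _ E).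
Qed.

(** The first bound compares total price with total load, by [c0 * (c - c0) <= c * (c - c0)]. The
    second is of Markov type: an overloaded vertex contributes at least [S] times its load to the
    left side of the hypothesis. *)
Lemma packing_overload (V : finType) (c : V -> nat) c0 N S :
  \sum_v c v * ((c v).-1 - c0) <= N * \sum_v c v ->
  c0 * \sum_v (c v - c0) <= N.+1 * \sum_v c v /\
  S * \sum_(v | c0 + S < c v) c v <= N * \sum_v c v.
Proof.
move=> H; split.
  apply: (@leq_trans (\sum_v c v * ((c v).-1 - c0) + \sum_v c v)); last first.
    by rewrite mulSn addnC leq_add2l.
  rewrite big_distrr -big_split /=; apply: leq_sum => v _.
  by have [|] := leqP (c v) c0; [|move: (c v) => [|y]]; nia.
apply: leq_trans H; rewrite big_distrr big_mkcond /=; apply: leq_sum => v _.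
by case: ifP => // lt; rewrite mulnC leq_mul2l; apply/orP; right; move: lt; lia.
Qed.

(** [x] is the precision: the final inequality is a division-free form of [q] having at least
    [(2/(r+1) - O(1/x)) #|V|] vertices. *)
Lemma almost_mono_path_linked r x : 0 < r -> 0 < x -> exists d K n0 : nat, 0 < d /\
  forall (V : finType) (eG : rel V) (col : V -> V -> 'I_r),
  n0 <= #|V| -> symmetric eG -> (forall a b, col a b = col b a) ->
  (forall X Y : {set V}, [disjoint X & Y] -> #|V| <= d * #|X| -> #|V| <= d * #|Y| ->
     exists a b, [/\ a \in X, b \in Y & eG a b]) ->
  exists (q : seq V) (i : 'I_r), [/\ uniq q, sorted eG q,
    defects (fun a b => col a b != i) q <= K &
    2 * x * (x - 1) ^ 2 * #|V| <= r.+1 * (x + 1) ^ 2 * (x * size q + 2 * #|V|)].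
Proof.
move=> r0 x0.
(* [D] is the free load [2 * x ^ 3] plus a slack [2 * x ^ 2]. The sizes [m i] drop by factors [L],
   making the losses inside pairs negligible. The choice of [d] makes [m 0] small against [n], and
   [K] bounds the number of pairs, whose sides have at least [n / d] vertices. *)
have [D DE] : exists D, D = 2 * x ^ 2 * (x + 1) by eexists.
have [L LE] : exists L, L = 6 * D * x by eexists.
have [d dE] : exists d, d = 2 * L ^ r * (2 * 3 ^ r * x) by eexists.
have [K KE] : exists K, K = D * d by eexists.
have D0 : 0 < D by rewrite DE !muln_gt0 x0 addn1.
have L0 : 0 < L by rewrite LE !muln_gt0 D0 x0.
have d0 : 0 < d by rewrite dE !muln_gt0 !expn_gt0 L0 x0.
exists d, K, (d + x * (K * (1 + 2 * 2 ^ (K * 2)))); split => // V eG col nV Gsym colC HG.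
set n := #|V|; set u := (n %/ d).+1.
have nu : n <= u * d by apply/ltnW/ltn_ceil.
have ud : u * d <= 2 * n.
  by rewrite mulSn; have := leq_trunc_div n d; move: nV; rewrite -/n; lia.
pose m i := L ^ (r - i) * u.
have HGu (X Y : {set V}) : [disjoint X & Y] -> u <= #|X| -> u <= #|Y| ->
     exists a b, [/\ a \in X, b \in Y & eG a b].
  move=> dXY uX uY; apply: HG => //; apply: leq_trans nu _; rewrite mulnC leq_mul2l ?uX ?uY ?orbT //.
pose e i : rel V := fun a b => eG a b && (col a b == i).
have esym i : symmetric (e i) by move=> a b; rewrite /e Gsym colC.
have Hs i := @packing (2 * x ^ 3) x V _ (good_pair (e i) (m i) (m i.+1)) (@pair_block V).
have [s Hs'] := fin_all_exists Hs.
pose c i := cnt (@pair_block V) (s i).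
pose h i v := c i v - 2 * x ^ 3.
have [|i Hi] := @cover_bound V r x (m 0) h r0 x0.
  move=> X Y dXY mX mY.
  have [|i [A [B [sA sB cA cB lAB]]]] := @linked_pair_exists V r e m X Y _ dXY mX mY.
    move=> X' Y' dXY'; rewrite /m subnn expn0 mul1n => uX uY.
    have [a [b [aX bY Gab]]] := HGu X' Y' dXY' uX uY.
    by exists (col a b), a, b; split => //; rewrite /e Gab eqxx.
  have dAB : [disjoint A & B] := disjointW sA sB dXY.
  have [_ Hadd _] := Hs' i.
  have := Hadd (A, B); rewrite /good_pair /= dAB cA cB !eqxx lAB => /(_ isT).
  rewrite /pair_block /= cardsU disjoint_setI0 // cards0 subn0 cA cB.
  rewrite (eq_bigl [predU A & B]) ?bigU //= => [H|v]; last by rewrite !inE.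
  have mpos : 0 < m i by rewrite muln_gt0 expn_gt0 L0.
  have [a0 a0A] : exists a, a \in A by apply/set0Pn; rewrite -card_gt0 cA.
  have [b0 b0B] : exists b, b \in B by apply/set0Pn; rewrite -card_gt0 cB.
  (* The dearest vertices of the two sides have prices adding up to at least [2 * x], since the
     block costs at least [x] per vertex on average. *)
  have [a aA amax] := arg_maxnP (h i) a0A.
  have [b bB bmax] := arg_maxnP (h i) b0B.
  exists i, a, b; split; [exact: (subsetP sA)|exact: (subsetP sB)|].
  have HA : \sum_(v in A) h i v <= m i * h i a.
    by rewrite -cA -sum_nat_const; apply: leq_sum => v /amax.
  have HB : \sum_(v in B) h i v <= m i * h i b.
    by rewrite -cB -sum_nat_const; apply: leq_sum => v /bmax.
  rewrite -(leq_pmul2l mpos) mulnDr; apply: leq_trans (leq_add HA HB).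
  by apply: leq_trans H; apply: eq_leq; move: (m i) => y; lia.
have [gs _ Hrem] := Hs' i.
have [H1 H2] := packing_overload (2 * x ^ 2) Hrem.
have Deq : 2 * x ^ 3 + 2 * x ^ 2 = D by rewrite DE mulnDr muln1 expnSr mulnA.
rewrite Deq in H2.
have [|q [uq sq dq Hq]] := packing_path (esym i) _ HGu gs D0; first by move=> a b /andP[].
have size_s : 2 * m i * size (s i) = \sum_v c i v.
  under eq_bigr do rewrite -[c i _]muln1.
  rewrite -sum_cnt -sum1_size big_distrr /= !big_seq; apply: eq_bigr => t /(allP gs).
  case/and4P=> dt /eqP c1 /eqP c2 _.
  by rewrite sum1_card cardsU disjoint_setI0 // cards0 subn0 c1 c2 mul2n addnn muln1.
have le_c : \sum_v c i v <= D * n + \sum_(v | D < c i v) c i v.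
  rewrite [X in _ + X]big_mkcond mulnC -sum_nat_const -big_split /=.
  by apply: leq_sum => v _; case: leqP; lia.
rewrite -/(c i) in Hq H1 H2; rewrite -/(h i) in H1.
move: (\sum_(v | _) _) H2 Hq le_c => O H2 Hq le_c.
move: (\sum_v c i v) (\sum_v h i v) H1 H2 Hq le_c size_s Hi => Sg H H1 H2 Hq le_c size_s Hi.
have mu : u <= m i by rewrite leq_pmull // expn_gt0 L0.
have mS : L * m i.+1 = m i by rewrite /m mulnA -expnS -subSn ?ltn_ord.
have mL : L * u <= m i.
  by rewrite -mS leq_mul2l leq_pmull ?orbT // expn_gt0 L0.
have m0n : 2 * (3 ^ r * (2 * m 0)) * x <= 2 * n.
  by apply: leq_trans ud; rewrite /m subn0 dE; apply: eq_leq; lia.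
exists q, i; rewrite -/n.
have O2 : 2 * x * O <= Sg.
  by rewrite -(leq_pmul2l x0); apply: leq_trans H2; apply: eq_leq; lia.
(* Overloaded vertices carry at most half of the total load, which is therefore at most
   [2 * D * n]. *)
have TM : size (s i) * m i <= D * n.
  have : 2 * O <= Sg by apply: leq_trans O2; rewrite leq_mul2r leq_pmulr // orbT.
  by move: size_s le_c; clear; move: (m i) (D * n) => y z; lia.
have sK : size (s i) <= K.
  rewrite -(@leq_pmul2r u) //; apply: (@leq_trans (size (s i) * m i)).
    by rewrite leq_mul2l mu orbT.
  by apply: leq_trans TM _; rewrite KE -mulnA leq_mul2l mulnC nu orbT.
have XK : 2 ^ (size (s i) * 2) <= 2 ^ (K * 2) by rewrite leq_exp2l // leq_mul2r sK orbT.
split => //.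
  apply: leq_trans sK; apply: leq_trans dq; apply: defects_le => a b.
  by rewrite /e negb_and orbC => ->.
(* The linear and the constant error terms of the path length are each at most [n / x]. *)
have c1 : x * (size (s i) * (4 * m i.+1 + 2 * u)) <= n.
  have D6 : 0 < 6 * D by rewrite muln_gt0 D0.
  rewrite -(leq_pmul2l D6); apply: (@leq_trans (6 * (size (s i) * m i))).
    have -> : 6 * D * (x * (size (s i) * (4 * m i.+1 + 2 * u)))
        = size (s i) * (4 * (L * m i.+1) + 2 * (L * u)) by rewrite LE; lia.
    have -> : 6 * (size (s i) * m i) = size (s i) * (4 * m i + 2 * m i) by lia.
    by rewrite leq_mul2l mS leq_add2l leq_mul2l mL !orbT.
  by rewrite -mulnA leq_mul2l TM orbT.
have c2 : x * (size (s i) * (1 + 2 * 2 ^ (size (s i) * 2))) <= n.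
  apply: leq_trans (leq_trans (leq_addl _ _) nV).
  by rewrite leq_mul2l leq_mul ?orbT // leq_add2l leq_mul2l XK ?orbT.
have c3 : x * Sg <= Sg + D * (x * size q + 2 * n).
  apply: (@leq_trans (x * (2 * O) + D * (x * size q + (n + n)))); last first.
    by rewrite addnn -mul2n leq_add2r mulnA [x * 2]mulnC.
  apply: leq_trans (_ : x * (2 * O) + D * (x * size q + (x * (size (s i) * (4 * m i.+1 + 2 * u))
      + x * (size (s i) * (1 + 2 * 2 ^ (size (s i) * 2))))) <= _); last first.
    by rewrite leq_add2l leq_mul2l leq_add2l leq_add ?orbT.
  apply: (@leq_trans (x * (2 * O + D * (size q + size (s i) * (4 * m i.+1 + 1 + 2 * u + 2 * 2 ^ (size (s i) * 2)))))).
    by rewrite leq_mul2l Hq orbT.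
  by apply: eq_leq; move: (2 ^ _) => y; lia.
move: (x * size q + 2 * n) c3 => B c3.
have c4 : (x - 1) * Sg <= D * B.
  by rewrite mulnBl mul1n leq_subLR.
have c5 : (x - 1) * x * H <= (x + 1) ^ 2 * B.
  have x2 : 0 < 2 * x ^ 2 by rewrite muln_gt0 expn_gt0 x0.
  rewrite -(leq_pmul2l x2); apply: (@leq_trans ((x + 1) * ((x - 1) * Sg))).
    have -> : 2 * x ^ 2 * ((x - 1) * x * H) = (x - 1) * (2 * x ^ 3 * H).
      by rewrite [x ^ 3]expnSr; move: (x - 1) (x ^ 2) => y z; lia.
    have -> : (x + 1) * ((x - 1) * Sg) = (x - 1) * (x.+1 * Sg).
      by rewrite addn1; move: (x - 1) => y; lia.
    by rewrite leq_mul2l H1 orbT.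
  apply: (@leq_trans ((x + 1) * (D * B))); first by rewrite leq_mul2l c4 orbT.
  by apply: eq_leq; rewrite DE -[(x + 1) ^ 2]mulnn; move: (x + 1) (x ^ 2) => y z; lia.
have c6 : 2 * (x - 1) * n <= r.+1 * H.
  rewrite -mulnA mulnBl mul1n mulnBr leq_subLR.
  apply: leq_trans (_ : r.+1 * H + 2 * x * (3 ^ r * (2 * m 0)) <= _).
    by rewrite mulnA.
  by rewrite addnC leq_add2r; apply: leq_trans m0n; apply: eq_leq; lia.
apply: (@leq_trans (r.+1 * ((x - 1) * x * H))).
  have -> : 2 * x * (x - 1) ^ 2 * n = x * (x - 1) * (2 * (x - 1) * n).
    by rewrite -mulnn; move: (x - 1) => y; lia.
  have -> : r.+1 * ((x - 1) * x * H) = x * (x - 1) * (r.+1 * H) by move: (x - 1) => y; lia.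
  by rewrite leq_mul2l c6 orbT.
by rewrite -[r.+1 * _ * B]mulnA leq_mul2l c5 orbT.
Qed.

(** * The random graph *)

From mathcomp Require Import all_classical all_reals all_analysis.
Import Order.TTheory GRing.Theory Num.Theory.
Import numFieldNormedType.Exports.
Local Open Scope ring_scope.


Lemma gnp_weight_ge0 (R : realType) n (p : R) (E : {set {set 'I_n}}) :
  0 <= p <= 1 -> 0 <= gnp_weight p E.
Proof.
by move=> /andP[p0 p1]; apply: prodr_ge0 => e _; case: ifP; rewrite ?subr_ge0.
Qed.

(** Expand a product of binomials, one for each set of vertices, where presence has weight 0 on [F]
    and outside the pairs. *)
Lemma gnp_avoid (R : realType) n (p : R) (F : {set {set 'I_n}}) :
  F \subset pairs 'I_n ->
  \sum_(E in powerset (pairs 'I_n) | [disjoint E & F]) gnp_weight p E = (1 - p) ^+ #|F|.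
Proof.
move=> FP; pose P := pairs 'I_n.
pose f (e : {set 'I_n}) : R := if e \in P :\: F then p else 0.
pose g (e : {set 'I_n}) : R := if e \in P then 1 - p else 1.
have -> : (1 - p) ^+ #|F| = \prod_e (f e + g e).
  rewrite -prodr_const big_mkcond; apply: eq_bigr => e _.
  rewrite /f /g inE; have [eF|eF] /= := boolP (e \in F).
    by rewrite (fintype.subsetP FP e eF) add0r.
  by case: ifP => _; rewrite ?add0r // addrC subrK.
rewrite bigA_distr.
rewrite [RHS](bigID (fun E : {set {set 'I_n}} => (E \in powerset P) && [disjoint E & F])) /=.
rewrite [X in _ = _ + X]big1 ?addr0; last first.
  move=> E; rewrite powersetE negb_and => nE.
  suff [e eE fe] : exists2 e, e \in E & f e = 0.
    by apply/eqP/prodf_eq0; exists e => //; rewrite eE fe.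
  case/orP: nE => [/subsetPn[e eE eP]|].
    by exists e => //; rewrite /f inE (negbTE eP) andbF.
  rewrite -setI_eq0 => /finset.set0Pn[e]; rewrite inE => /andP[eE eF].
  by exists e => //; rewrite /f inE eF.
apply: eq_bigr => E /andP[]; rewrite powersetE => EP EF.
rewrite /gnp_weight big_mkcond /=; apply: eq_bigr => e _.
rewrite /f /g /P finset.in_setD; have [eE|eE] := boolP (e \in E).
  by rewrite (fintype.subsetP EP e eE) (disjointFr EF eE).
by case: (e \in pairs _).
Qed.

Definition cross (V : finType) (X Y : {set V}) : {set {set V}} :=
  [set [set x; y] | x in X, y in Y].

Lemma cross_pairs (V : finType) (X Y : {set V}) :
  [disjoint X & Y] -> cross X Y \subset pairs V.
Proof.
move=> dXY; apply/fintype.subsetP => e /imset2P[x y xX yY ->].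
rewrite inE cards2; have [xy|//] := eqVneq x y.
by have := disjointFr dXY xX; rewrite xy yY.
Qed.

Lemma card_cross (V : finType) (X Y : {set V}) :
  [disjoint X & Y] -> #|cross X Y| = (#|X| * #|Y|)%N.
Proof.
move=> dXY; rewrite -cardsX /cross curry_imset2X; apply: card_in_imset.
move=> [x y] [x' y']; rewrite !inE /= => /andP[xX yY] /andP[xX' yY'] E.
have ne a b : a \in X -> b \in Y -> a = b -> False.
  by move=> aX bY ab; have := disjointFr dXY aX; rewrite ab bY.
have : x \in [set x'; y'] by rewrite -E !inE eqxx.
have : y \in [set x'; y'] by rewrite -E !inE eqxx orbT.
rewrite !inE => /orP[/eqP yx'|/eqP ->]; first by case: (ne _ _ xX' yY).
by move=> /orP[/eqP ->//|/eqP xy']; case: (ne _ _ xX yY').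
Qed.

Lemma bernoulli (R : realType) (p : R) n : 0 <= p -> 1 + n%:R * p <= (1 + p) ^+ n.
Proof.
move=> p0; elim: n => [|n IHn]; first by rewrite mul0r addr0.
rewrite exprS; apply: le_trans (_ : (1 + p) * (1 + n%:R * p) <= _).
  by rewrite -natr1; have : 0 <= n%:R :> R by []; nra.
by rewrite ler_wpM2l // addr_ge0.
Qed.

(** By Bernoulli [(1 + p) ^+ n >= 8 ^+ (d ^ 2)], while [(1 - p) ^+ n * (1 + p) ^+ n <= 1]. The claim
    is compared after raising both sides to the power [d ^ 2]. *)
Lemma avoid_bound (R : realType) (p : R) n d f : 0 <= p <= 1 -> (0 < d)%N ->
  8 ^+ (d ^ 2) - 1 <= n%:R * p -> (n ^ 2 <= d ^ 2 * f)%N ->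
  (1 - p) ^+ f <= 8^-1 ^+ n.
Proof.
move=> /andP[p0 p1] d0 Cp nf.
have q0 : 0 <= 1 - p by rewrite subr_ge0.
have d2 : (0 < d ^ 2)%N by rewrite expn_gt0 d0.
rewrite -(ler_pXn2r d2) ?nnegrE ?exprn_ge0 // -!exprM.
apply: le_trans (_ : (1 - p) ^+ (n ^ 2) <= _).
  by rewrite ler_wiXn2l // ?gerBl // mulnC.
rewrite -[(n ^ 2)%N]mulnn [(n * d ^ 2)%N]mulnC (exprM _ n n) (exprM _ (d ^ 2) n).
apply: lerXn2r; rewrite ?nnegrE ?exprn_ge0 // exprVn.
have e8 : 0 < 8 ^+ (d ^ 2) :> R by rewrite exprn_gt0.
rewrite -[leRHS]mul1r ler_pdivlMr //.
apply: le_trans (_ : (1 - p) ^+ n * (1 + p) ^+ n <= _).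
  by rewrite ler_wpM2l ?exprn_ge0 //; have := bernoulli n p0; lra.
have -> : (1 - p) ^+ n * (1 + p) ^+ n = (1 - p * p) ^+ n by rewrite -exprMn; congr (_ ^+ n); ring.
have pp : p * p <= 1 by rewrite mulr_ile1.
by apply: exprn_ile1; rewrite ?subr_ge0 // gerBl mulr_ge0.
Qed.

(** Union bound: of the [4^n] pairs of sets, each large disjoint one spans no edge with probability
    at most [8^(-n)]. *)
Lemma gnp_prob_expand (R : realType) n d (p : R) (A : set {set {set 'I_n}}) :
  0 <= p <= 1 -> (0 < d)%N -> 8 ^+ (d ^ 2) - 1 <= n%:R * p ->
  (forall E : {set {set 'I_n}},
     (forall X Y : {set 'I_n}, [disjoint X & Y] -> (n <= d * #|X|)%N -> (n <= d * #|Y|)%N ->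
        exists a b, [/\ a \in X, b \in Y & adj E a b]) -> A E) ->
  1 - 2^-1 ^+ n <= gnp_prob p A <= 1.
Proof.
move=> p01 d0 Cp HA.
have w0 E : 0 <= gnp_weight p E := gnp_weight_ge0 E p01.
have S1 : gnp_prob p A + \sum_(E in powerset (pairs 'I_n) | ~~ `[< A E >]) gnp_weight p E = 1.
  rewrite -(gnp_prob_setT n p) /gnp_prob -bigID /=.
  by apply: eq_bigl => E; rewrite asboolT ?andbT.
suff : \sum_(E in powerset (pairs 'I_n) | ~~ `[< A E >]) gnp_weight p E <= 2^-1 ^+ n.
  have : 0 <= \sum_(E in powerset (pairs 'I_n) | ~~ `[< A E >]) gnp_weight p E.
    by apply: sumr_ge0.
  by move: (\sum_(E in _ | _) _) S1 => y; lra.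
pose bad (Z : {set 'I_n} * {set 'I_n}) :=
  [&& [disjoint Z.1 & Z.2], (n <= d * #|Z.1|)%N & (n <= d * #|Z.2|)%N].
apply: (@le_trans _ _ (\sum_(Z | bad Z) \sum_(E in powerset (pairs 'I_n) | [disjoint E & cross Z.1 Z.2]) gnp_weight p E)).
  rewrite (exchange_big_dep (fun E => E \in powerset (pairs 'I_n))) /=; last by move=> Z E _ /andP[].
  rewrite [leLHS]big_mkcondr; apply: ler_sum => E EP; case: ifP => [nA|_]; last first.
    by apply: sumr_ge0 => *.
  have [Z /andP[bZ dZ]] : exists Z, bad Z && [disjoint E & cross Z.1 Z.2].
    apply/existsP; apply: contraNT nA => /existsPn no; apply/asboolP/HA => X Y dXY nX nY.
    have := no (X, Y); rewrite /bad /= dXY nX nY /= -setI_eq0 => /finset.set0Pn[e].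
    by rewrite inE => /andP[eE /imset2P[x y xX yY ee]]; exists x, y; rewrite /adj -ee.
  rewrite (bigD1 Z) /=; last by rewrite bZ EP.
  by rewrite lerDl sumr_ge0.
apply: (@le_trans _ _ (\sum_(Z : {set 'I_n} * {set 'I_n}) 8^-1 ^+ n)).
  rewrite [leLHS]big_mkcond; apply: ler_sum => Z _; case: ifP; last by rewrite exprn_ge0.
  case/and3P => dZ n1 n2; rewrite gnp_avoid ?cross_pairs //.
  apply: avoid_bound d0 Cp _ => //; rewrite card_cross //.
  by have := leq_mul n1 n2; rewrite mulnACA !mulnn.
rewrite sumr_const card_prod -(cardsT {set 'I_n}) -powersetT card_powerset cardsT card_ord.
rewrite -[leLHS]mulr_natr natrM natrX -!exprMn.
by rewrite (_ : 8^-1 * _ = 2^-1) //; lra.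
Qed.

(** * Transfer of the deterministic statement to G(n,p) *)

Lemma defects_path_edges (V : finType) (T : eqType) (c : {set V} -> T) i (x : V) s :
  count (fun e => c e != i) (path_edges x s)
  = defects (fun a b => c [set a; b]%SET != i) (x :: s).
Proof.
rewrite /path_edges /defects; elim: s x => [//|y s IHs] x /=.
by rewrite IHs.
Qed.

(** The [- 1] accounts for a path having one edge fewer than vertices. *)
Lemma length_bound (R : realType) (eps : R) (r x n q : nat) :
  0 < eps -> (2 <= r)%N -> (0 < x)%N -> 7 <= eps * x%:R -> (x <= n)%N ->
  (2 * x * (x - 1) ^ 2 * n <= r.+1 * (x + 1) ^ 2 * (x * q + 2 * n))%N ->
  (2 / (r%:R + 1) - eps) * n%:R <= q%:R - 1.
Proof.
move=> e0 r2 x0 ex xn.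
rewrite -(ler_nat R) !natrM natrB // !natrD !natrM -[r.+1%:R]natr1.
have : 1 <= x%:R :> R by rewrite (ler_nat R 1).
have : 2 <= r%:R :> R by rewrite (ler_nat R 2).
have : 0 <= q%:R :> R by [].
rewrite -(ler_nat R) in xn; move: xn ex.
move: (n%:R : R) (x%:R : R) (r%:R : R) (q%:R : R) => N X a Q NX eX Q0 a2 X1 H.
(* Divide by [(X + 1) ^+ 2], using [(X + 1) ^+ 2 * (2 * X - 8) <= 2 * X * (X - 1) ^+ 2]. *)
have H1 : (2 * X - 8) * N <= (a + 1) * (X * Q + 2 * N).
  have X2 : 0 < (X + 1) ^+ 2 by rewrite exprn_gt0 //; lra.
  rewrite -(ler_pM2l X2); apply: le_trans (_ : 2 * X * (X - 1) ^+ 2 * N <= _); last by lra.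
  rewrite mulrA ler_wpM2r //; first by lra.
  by nra.
have aX : 0 < (a + 1) * X by nra.
rewrite -subr_ge0 -(pmulr_rge0 _ aX).
have -> : (a + 1) * X * (Q - 1 - (2 / (a + 1) - eps) * N)
  = (a + 1) * X * Q - (a + 1) * X - 2 * X * N + (a + 1) * N * (eps * X).
  by field; lra.
(* The losses [8 * N], [2 * (a + 1) * N] and [(a + 1) * X] total at most [6 * (a + 1) * N], as
   [2 <= a] and [X <= N]; the 7 absorbs them. *)
have : (a + 1) * N * 7 <= (a + 1) * N * (eps * X).
  by rewrite ler_wpM2l // mulr_ge0; lra.
have : (a + 1) * X <= (a + 1) * N by rewrite ler_wpM2l //; lra.
by nra.
Qed.

Local Open Scope classical_set_scope.

Theorem theorem1p5 (R : realType) (r : nat) (eps : R)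
    (hr : (2 <= r)%N) (heps : 0 < eps) :
  exists (C : R) (K : nat),
    forall p : nat -> R,
      (forall n, 0 <= p n <= 1) ->
      (\forall n \near \oo, C / n%:R <= p n) ->
      (fun n => gnp_prob (p n)
         [set E : {set {set 'I_n}} |
           almost_mono_path r K ((2 / (r%:R + 1) - eps) * n%:R) E])
        @ \oo --> (1 : R).
Proof.
pose x := (Num.trunc (7 / eps)).+1.
have ex : 7 <= eps * x%:R.
  rewrite mulrC -ler_pdivrMr //; apply/ltW; exact: truncnS_gt.
have [d [K [n0 [d0 H]]]] := almost_mono_path_linked (ltnW hr) (ltn0Sn _ : 0 < x)%N.
exists (8 ^+ (d ^ 2) - 1), K => p p01 pC.
have lo : (fun n => 1 - 2^-1 ^+ n) @ \oo --> (1 : R).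
  rewrite -[X in _ --> X]subr0; apply: cvgB; first exact: cvg_cst.
  by apply: cvg_expr; rewrite ger0_norm ?invf_lt1 ?invr_ge0 ?ltr1n.
apply: (squeeze_cvgr _ lo (cvg_cst (1 : R))).
near=> n.
have n1 : (0 < n)%N by near: n; exact: nbhs_infty_gt.
have nx : (x <= n)%N by near: n; exact: nbhs_infty_ge.
have nn0 : (n0 <= n)%N by near: n; exact: nbhs_infty_ge.
apply: (gnp_prob_expand (d := d)) => //.
  by rewrite mulrC -ler_pdivrMr ?ltr0n //; near: n.
move=> E HE c.
have [||||q [i [uq sq dq Hq]]] := H 'I_n (adj E) (fun a b => c [set a; b]%SET).
- by rewrite card_ord.
- by move=> a b; rewrite /adj finset.setUC.
- by move=> a b; rewrite finset.setUC.
- by rewrite card_ord.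
rewrite card_ord in Hq.
have len := length_bound heps hr (ltn0Sn _) ex nx Hq.
(* An empty [q] is replaced by a single vertex; the required length is then negative. *)
case: q uq sq dq len {Hq} => [|a s] uq sq dq len.
  exists (Ordinal n1), [::]; split => //; first by apply: le_trans len _; rewrite /=; lra.
  by exists i.
exists a, s; split; first by rewrite /is_path uq andbT.
  by apply: le_trans len _; rewrite /= -natr1; lra.
by exists i; rewrite defects_path_edges.
Unshelve. all: by end_near.
Qed.
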